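(* Let $X$ be a Tychonoff space. (i) If $C_p(X)$ is an Ascoli space, then $C_p(X)$ is $\kappa$-Fréchet–Urysohn. (ii) If $C_p(X)$ is $\kappa$-Fréchet–Urysohn and every compact subset $K\subset C_k(C_p(X))$ is first-countable (in the subspace topology), then $C_p(X)$ is an Ascoli space.
   Context: For a Tychonoff space $X$, $C_p(X)$ and $C_k(X)$ denote the set $C(X)$ of all continuous real-valued functions on $X$ with the topology of pointwise convergence and the compact-open topology, respectively. A Tychonoff space $Y$ is called Ascoli if every compact subset $\mathcal K$ of $C_k(Y)$ is evenly continuous, i.e. the evaluation map $Y\times\mathcal K\to\mathbb R$, $(y,f)\mapsto f(y)$, is continuous (where $\mathcal K$ carries the subspace topology from $C_k(Y)$). A topological space $Y$ is $\kappa$-Fréchet–Urysohn if for every open $U\subseteq Y$ and every $y\in\overline U$ there is a sequence of points of $U$ converging to $y$. *)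

(* Defs.v *)
From HB Require Import structures.
From mathcomp Require Import all_boot all_order all_algebra.
From mathcomp Require Import all_classical all_reals all_analysis.
Import numFieldNormedType.Exports.

Set Implicit Arguments.
Unset Strict Implicit.
Unset Printing Implicit Defensive.

Local Open Scope classical_set_scope.

(* The library puts no topology on [continuousType X R] itself, so each of the
   two topologies on C(X) gets its own alias of that type. *)
Definition Cp (R : realType) (X : topologicalType) : Type := continuousType X R.

HB.instance Definition _ (R : realType) (X : topologicalType) :=
  Topological.copy (Cp R X)
    (initial_topology ((fun f => f) : continuousType X R -> {ptws X -> R})).

Definition Ck (R : realType) (X : topologicalType) : Type := continuousType X R.

HB.instance Definition _ (R : realType) (X : topologicalType) :=
  Topological.copy (Ck R X)
    (initial_topology
       ((fun f => f) : continuousType X R -> {compact-open, X -> R})).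

Definition tychonoff_space (X : topologicalType) : Prop :=
  hausdorff_space X /\ completely_regular_space X.

(* [set_type K] is K with the subspace topology of [Ck R Y]. *)
Definition evenly_continuous (R : realType) (Y : topologicalType)
    (K : set (Ck R Y)) : Prop :=
  continuous (fun p : Y * set_type K => (set_val p.2 : Ck R Y) p.1 : R).

Definition ascoli_space (R : realType) (Y : topologicalType) : Prop :=
  tychonoff_space Y /\
  forall K : set (Ck R Y), compact K -> evenly_continuous K.

Definition kappa_frechet_urysohn (Y : topologicalType) : Prop :=
  forall (U : set Y) (y : Y), open U -> closure U y ->
    exists2 u : nat -> Y, (forall n, U (u n)) & u @ \oo --> y.

Definition first_countable (T : topologicalType) : Prop :=
  forall x : T, exists B : set (set T),
    [/\ countable B, B `<=` nbhs x &
        forall U, nbhs x U -> exists2 V, B V & V `<=` U].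

(* Main.v *)
(* (i) Let y be in the closure of the open set U of C_p(X). Recursively choose
   finite sets F_n increasing with n and functions g_n within 1/(n+1) of y on
   F_n such that every function equal to g_n on F_(n+1) lies in U. A point
   belongs to at most one of the D_n = F_(n+1) \ F_n. If every compact
   C of C_p(X) met only finitely many of the open sets {f | f > n on D_n}, the
   functions psi_n(f) = prod_(x in D_n) max(0, f x - n) would tend to 0 in
   C_k(C_p(X)) although every neighbourhood of 0 contains, for n large, some f
   with psi_n(f) = 1: this contradicts the Ascoli property. So some compact C,
   which is pointwise bounded, contains f > n on D_n for infinitely many n;
   truncating g_n - y at a height controlled by f then gives members of U that
   converge to y.

   (ii) If even continuity of K fails at (y, k), the points at which some
   member of the n-th basic neighbourhood of k is far from k(y) form an open
   set U_n whose closure contains y. A diagonal argument provides points of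
   the U_n converging to y, and with y these form a compact set on which
   the members of K close to k are uniformly close to k. *)

Require Import Defs.
From mathcomp Require Import all_boot all_order all_algebra.
From mathcomp Require Import lra.
From mathcomp Require Import all_classical all_reals all_analysis.
Import numFieldNormedType.Exports.

Set Implicit Arguments.
Unset Strict Implicit.
Unset Printing Implicit Defensive.

Import Order.TTheory GRing.Theory Num.Theory.
Local Open Scope classical_set_scope.
Local Open Scope ring_scope.

(** * Convergence and neighbourhoods in the two topologies on C(X) *)

Lemma continuous_maxr (R : realType) (T : topologicalType) (f g : T -> R) :
  continuous f -> continuous g -> continuous (fun x => Num.max (f x) (g x)).
Proof.
move=> cf cg.
have -> : (fun x => Num.max (f x) (g x)) =
    (fun x => (f x + g x + `|f x - g x|) / 2).
  by apply/funext => x; rewrite maxr_absE.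
move=> x; apply: cvgMr_tmp; apply: cvgD; first exact: cvgD (cf x) (cg x).
by apply: cvg_norm; exact: cvgB (cf x) (cg x).
Qed.

Lemma Cp_cvgP (R : realType) (X : topologicalType) (F : set_system (Cp R X))
    (f : Cp R X) : Filter F ->
  F --> f <-> forall x, g x @[g --> F] --> f x.
Proof.
move=> FF; split=> [Ff x|Ff].
  have : {ptws, ((fun h : Cp R X => h : X -> R) @ F) --> (f : X -> R)}.
    apply: (cvg_comp _ _ Ff).
    exact: (@initial_continuous (continuousType X R) {ptws X -> R} (fun h => h)).
  by move=> /pointwise_cvgP /(_ x).
have /(pointwise_cvgP (f : X -> R)) H :
    forall x, (fun h : X -> R => h x) @ ((fun h : Cp R X => h : X -> R) @ F) --> f x.
  exact: Ff.
move=> A [_ [[B oB <-] Bf] BA]; apply: (filterS BA).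
by apply: H; apply: open_nbhs_nbhs.
Qed.

Lemma Ck_cvgP (R : realType) (X : topologicalType) (F : set_system (Ck R X))
    (f : Ck R X) : Filter F ->
  F --> f <-> forall K O, compact K -> open O -> (f : X -> R) @` K `<=` O ->
    F [set g : Ck R X | (g : X -> R) @` K `<=` O].
Proof.
move=> FF; split=> [Ff K O cK oO fKO|Ff].
  have : {compact-open, ((fun h : Ck R X => h : X -> R) @ F) --> (f : X -> R)}.
    apply: (cvg_comp _ _ Ff).
    exact: (@initial_continuous (continuousType X R) {compact-open, X -> R} (fun h => h)).
  by move=> /compact_open_cvgP; apply.
have : {compact-open, ((fun h : Ck R X => h : X -> R) @ F) --> (f : X -> R)}.
  by apply/compact_open_cvgP.
move=> H A [_ [[B oB <-] Bf] BA]; apply: (filterS BA).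
by apply: H; apply: open_nbhs_nbhs.
Qed.

Lemma continuousType_ex (X Y : topologicalType) (f : X -> Y) :
  continuous f -> exists g : continuousType X Y, forall x, g x = f x.
Proof.
by move=> cf; exists (Continuous.Pack (Continuous.Class (isContinuous.Build _ _ f cf))).
Qed.

Lemma Cp_eval_continuous (R : realType) (X : topologicalType) (x : X) :
  continuous (fun f : Cp R X => f x).
Proof. by move=> f; have /Cp_cvgP/(_ x) : nbhs f --> f by []. Qed.

Lemma Cp_tychonoff (R : realType) (X : topologicalType) :
  tychonoff_space (Cp R X).
Proof.
split; last exact: (@uniform_completely_regular R
  (initial_topology ((fun f => f) : continuousType X R -> {ptws X -> R}))).
move=> f g fg; apply/continuousEP => x.
apply: (@Rhausdorff R) => A B Af Bg.
have ev := @Cp_eval_continuous R X x.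
have [h [Ah Bh]] := fg _ _ (ev _ _ Af) (ev _ _ Bg).
by exists (h x).
Qed.

Lemma Cp_nbhs_finite (R : realType) (X : topologicalType) (f : Cp R X)
    (s : seq X) (e : R) : 0 < e ->
  nbhs f [set g : Cp R X | {in s, forall x, `|f x - g x| < e}].
Proof.
move=> e0; elim: s => [|a s IH]; first by apply: filterS filterT => g _ x.
have /cvgrPdist_lt/(_ e e0) fa := @Cp_eval_continuous R X a f.
by apply: filterS2 fa IH => g ga gs x; rewrite inE => /predU1P[->//|/gs].
Qed.

(** The sets [B (s, e)] generate a filter that converges to [f] at every point, so by [Cp_cvgP] it
    contains each neighbourhood of [f]. *)
Lemma Cp_nbhs_basis (R : realType) (X : topologicalType) (f : Cp R X)
    (A : set (Cp R X)) : nbhs f A ->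
  exists (s : seq X) (e : R), 0 < e /\
    forall g : Cp R X, {in s, forall x, `|f x - g x| < e} -> A g.
Proof.
pose B (p : seq X * R) :=
  [set g : Cp R X | {in p.1, forall x, `|f x - g x| < p.2}].
pose F := filter_from [set p : seq X * R | 0 < p.2] B.
have FF : Filter F.
  apply: filter_from_filter; first by exists ([::], 1) => /=.
  move=> [s1 e1] [s2 e2] /= e10 e20.
  exists (s1 ++ s2, Num.min e1 e2); first by rewrite /= lt_min e10.
  move=> g gP; split=> x xs /=; have := gP x; rewrite /= mem_cat xs ?orbT.
    by move=> /(_ isT); rewrite lt_min => /andP[].
  by move=> /(_ isT); rewrite lt_min => /andP[].
have : F --> f.
  apply/Cp_cvgP => x; apply/cvgrPdist_lt => e e0.
  by exists ([:: x], e) => //= g /(_ x); apply; rewrite inE.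
by move=> /[apply] -[[s e] /= e0 sA]; exists s, e.
Qed.

(** If [l] is not a cluster point of [F], some member of [F] misses a neighbourhood of [l], hence a
    tail of [u]; [F] then lives on finitely many terms, and a finite set is compact. *)
Lemma cvg_compact_range (T : topologicalType) (u : nat -> T) (l : T) :
  u @ \oo --> l -> compact (range u `|` [set l]).
Proof.
move=> ul F PF FS; have [Fl|] := pselect (cluster F l).
  by exists l; split => //; right.
move=> /existsNP[A] /existsNP[B] /not_implyP[FA] /not_implyP[Bl AB0].
have [N _ NB] := ul _ Bl.
have FN : F (u @` `I_N).
  apply: filterS (filterI FS FA) => t [[[n _ <-]|->] At]; last first.
    by exfalso; apply: AB0; exists l; split=> //; exact: nbhs_singleton.
  have [Nn|nN] := leqP N n; last by exists n.
  by exfalso; apply: AB0; exists (u n); split=> //; exact: NB.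
have [t [[n _ <-] Ft]] :=
  finite_compact (finite_image u (finite_II N)) PF FN.
by exists (u n); split => //; left; exists n.
Qed.

(** * The Ascoli property along a convergent sequence *)

Lemma Ck_cvg_stationary (R : realType) (Y : topologicalType)
    (psi : nat -> Ck R Y) (phi : Ck R Y) :
  (forall C : set Y, compact C ->
    exists N, forall n, (N <= n)%N -> {in C, psi n =1 phi}) ->
  psi @ \oo --> phi.
Proof.
move=> H; apply/Ck_cvgP => C O cC oO phiO; have [N NP] := H C cC.
exists N => // n /= Nn _ [y Cy <-]; rewrite NP ?inE//.
by apply: phiO; exists y.
Qed.

(** Even continuity of the compact set formed by the [psi n] and [phi], taken at [(y, phi)]. *)
Lemma ascoli_cvg (R : realType) (Y : topologicalType)
    (psi : nat -> Ck R Y) (phi : Ck R Y) (y : Y) (e : R) :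
  ascoli_space R Y -> psi @ \oo --> phi -> 0 < e ->
  exists2 V, nbhs y V &
    exists N, forall n v, (N <= n)%N -> V v -> `|phi y - psi n v| < e.
Proof.
move=> [_ asc] psiphi e0.
pose K := range psi `|` [set phi].
have Kphi : K phi by right.
have Kpsi n : K (psi n) by left; exists n.
have /cvgrPdist_lt/(_ e e0)[[V W] /= [Vy Wphi] VW] :=
  asc K (cvg_compact_range psiphi) (y, exist _ phi (mem_set Kphi)).
move: Wphi => -[_ [[B oB <-] Bphi] BW].
have [N _ NB] := psiphi B (open_nbhs_nbhs (conj oB Bphi)).
exists V => //; exists N => n v Nn Vv.
apply: (VW (v, exist _ (psi n) (mem_set (Kpsi n)))); split => //.
by apply: BW; exact: NB.
Qed.

(** * Statement (i): from Ascoli to kappa-Fréchet-Urysohn *)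

Lemma tychonoff_interpolation (R : realType) (X : topologicalType)
    (s d : seq X) (c : R) :
  tychonoff_space X -> {in d, forall x, x \notin s} ->
  exists f : Cp R X, {in s, forall x, f x = 0} /\ {in d, forall x, f x = c}.
Proof.
move=> [hX crX] ds.
suff [f [cf fs fd]] : exists f : X -> R,
    [/\ continuous f, {in s, forall x, f x = 1} & {in d, forall x, f x = 0}].
  have /continuousType_ex[g gE] : continuous (fun x => c * (1 - f x)).
    by move=> x; apply: cvgMl_tmp; apply: cvgB; [exact: cvg_cst|exact: cf].
  exists g; split=> x xs; rewrite gE; first by rewrite fs// subrr mulr0.
  by rewrite fd// subr0 mulr1.
(* Each point [a] of [d] contributes a factor that is 0 at [a] and 1 on [s], which is closed because
   it is finite. *)
elim: d ds => [_|a d IH ds].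
  by exists (fun=> 1); split=> // x; exact: cvg_cst.
have [|f [cf fs fd]] := IH; first by move=> x xd; apply: ds; rewrite inE xd orbT.
have cls : closed [set` s].
  have := hausdorff_accessible hX => /accessible_finite_set_closed; apply.
  exact: finite_seq.
have /(crX _ _ cls)/(@uniform_separatorP _ R)[g [cg _ ga gs]] : ~ [set` s] a.
  by apply/negP; apply: ds; rewrite inE eqxx.
exists (fun x => f x * g x); split.
- by move=> x; exact: cvgM (cf x) (cg x).
- by move=> x xs; rewrite fs// mul1r; apply: gs; exists x.
- move=> x; rewrite inE => /predU1P[->|xd]; last by rewrite fd// mul0r.
  by rewrite (_ : g a = 0) ?mulr0//; apply: ga; exists a.
Qed.

Lemma continuous_prod_seq (R : realType) (T : topologicalType) (I : Type)
    (s : seq I) (f : I -> T -> R) :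
  (forall i, continuous (f i)) -> continuous (fun t => \prod_(i <- s) f i t).
Proof.
move=> cf; elim: s => [|i s IH].
  under [X in continuous X]eq_fun do rewrite big_nil.
  by move=> t; exact: cvg_cst.
under [X in continuous X]eq_fun do rewrite big_cons.
by move=> t; exact: cvgM (cf i t) (IH t).
Qed.

Lemma Cp_evalB_continuous (R : realType) (X : topologicalType) (x : X) (c : R) :
  continuous (fun f : Cp R X => f x - c).
Proof. by move=> f; exact: cvgB (@Cp_eval_continuous R X x f) (cvg_cst c). Qed.

Lemma Cp_ascoli_family (R : realType) (X : topologicalType)
    (D : nat -> seq X) :
  tychonoff_space X -> ascoli_space R (Cp R X) ->
  (forall x, exists N, forall n, (N <= n)%N -> x \notin D n) ->
  exists2 C : set (Cp R X), compact C &
    forall N, exists n (f : Cp R X),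
      [/\ (N <= n)%N, C f & {in D n, forall x, n%:R < f x}].
Proof.
move=> tX asc Dfin; apply: contrapT => noC.
have cpsi n : continuous (fun f : Cp R X =>
    \prod_(x <- D n) Num.max 0 (f x - n%:R)).
  apply: continuous_prod_seq => a; apply: continuous_maxr.
    exact: cst_continuous.
  exact: Cp_evalB_continuous.
have /choice[psi psiE] n := continuousType_ex (@cpsi n).
have [phi phiE] :=
  continuousType_ex (@cst_continuous (Cp R X) _ (0 : R)).
have psi_cvg : (psi : nat -> Ck R (Cp R X)) @ \oo --> (phi : Ck R (Cp R X)).
  apply: Ck_cvg_stationary => C cC.
  have : ~ forall N, exists n (f : Cp R X),
      [/\ (N <= n)%N, C f & {in D n, forall x, n%:R < f x}].
    by move=> H; apply: noC; exists C.
  move=> /existsNP[N NP]; exists N => n Nn f; rewrite inE => Cf.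
  (* Some [x] in [D n] has [f x <= n], so its factor in the product vanishes. *)
  rewrite psiE phiE; apply/eqP; rewrite prodf_seq_eq0; apply/hasP.
  apply: contrapT => nD; apply: NP; exists n, f; split=> // x xD.
  rewrite ltNge; apply/negP => fx; apply: nD; exists x => //=.
  by apply/eqP/max_idPl; rewrite subr_le0.
have [z zE] := continuousType_ex (@cst_continuous X _ (0 : R)).
have [V /Cp_nbhs_basis[s [e [e0 sV]]] [N VN]] :=
  ascoli_cvg (z : Cp R X) asc psi_cvg (@ltr01 R).
have [M MP] : exists M, forall n, (M <= n)%N -> {in D n, forall x, x \notin s}.
  elim: (s) => [|a s' [M MP]]; first by exists 0%N.
  have [M' MP'] := Dfin a; exists (maxn M M') => n.
  rewrite geq_max => /andP[Mn M'n] x xD; rewrite inE negb_or (MP n)// andbT.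
  by apply: contraNneq (MP' n M'n) => <-.
(* [g] vanishes on [s], hence lies in [V]; on [D n] it is [n + 1], so every factor is 1 and
   [psi n g = 1], against the bound [< 1]. *)
pose n := maxn N M.
have [g [gs gD]] := @tychonoff_interpolation R X s (D n) (n%:R + 1) tX
  (MP n (leq_maxr _ _)).
have Vg : V g by apply: sV => x xs; rewrite zE gs// subrr normr0.
have := VN n g (leq_maxl _ _) Vg; rewrite phiE psiE big_seq big1.
  by rewrite sub0r normrN1 ltxx.
by move=> x xD; rewrite gD// addrAC subrr add0r; apply/max_idPr; exact: ler01.
Qed.

(** The expression clamps [d] to [[-r, r]]; the inner minimum is written as a negated maximum so
    that [continuous_maxr] covers continuity. *)
Lemma truncation_le (R : realDomainType) (r d : R) :
  0 <= r -> `|Num.max (- r) (- Num.max (- r) (- d))| <= r.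
Proof.
move=> r0; rewrite ler_norml le_max lexx/= ge_max.
by rewrite ge0_cp//= lerNl le_max lexx.
Qed.

Lemma truncation_id (R : realDomainType) (r d : R) :
  `|d| <= r -> Num.max (- r) (- Num.max (- r) (- d)) = d.
Proof.
rewrite ler_norml => /andP[rd dr].
have /max_idPr -> : - r <= - d by rewrite lerN2.
by rewrite opprK; apply/max_idPr.
Qed.

Lemma ascoli_kappa (R : realType) (X : topologicalType) :
  tychonoff_space X -> ascoli_space R (Cp R X) -> kappa_frechet_urysohn (Cp R X).
Proof.
move=> tX asc U y oU Uy.
have eps0 n : 0 < n.+1%:R^-1 :> R by rewrite invr_gt0 ltr0n.
(* [t] holds the current finite set and the stage; the answer is the approximant [g] with an
   enlarged set whose values decide membership in [U]. *)
have step (t : seq X * nat) : exists p : Cp R X * seq X,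
    [/\ {in t.1, forall x, `|y x - p.1 x| < t.2.+1%:R^-1},
        {subset t.1 <= p.2} &
        forall h : Cp R X, {in p.2, h =1 p.1} -> U h].
  have [g [Ug gy]] := Uy _ (Cp_nbhs_finite y t.1 (eps0 t.2)).
  have [s [e [e0 sU]]] := Cp_nbhs_basis (open_nbhs_nbhs (conj oU Ug)).
  exists (g, t.1 ++ s); split => //= [x xt|h hg]; first by rewrite mem_cat xt.
  by apply: sU => x xs; rewrite hg ?subrr ?normr0// mem_cat xs orbT.
have /choice[G GP] := step.
pose F := nat_rect (fun=> seq X) [::] (fun n s => (G (s, n)).2).
pose g n := (G (F n, n)).1.
have gF n : {in F n, forall x, `|y x - g n x| < n.+1%:R^-1}.
  by case: (GP (F n, n)).
have gU n (h : Cp R X) : {in F n.+1, h =1 g n} -> U h.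
  by case: (GP (F n, n)) => _ _; exact.
have FS n : {subset F n <= F n.+1} by case: (GP (F n, n)).
have Fle m n : (m <= n)%N -> {subset F m <= F n}.
  move=> /subnKC <-; elim: (n - m)%N => [|k IH]; first by rewrite addn0.
  by move=> x /IH xF; rewrite addnS; exact: FS.
pose D n := [seq x <- F n.+1 | x \notin F n].
have Dfin x : exists N, forall n, (N <= n)%N -> x \notin D n.
  have [[m xm]|nx] := pselect (exists m, x \in F m).
    by exists m => n mn; rewrite mem_filter (Fle m n).
  exists 0%N => n _; rewrite mem_filter; apply/negP => /andP[_ xF].
  by apply: nx; exists n.+1.
have [C cC CP] := Cp_ascoli_family tX asc Dfin.
(* The factor of [|g n x - y x|] is at least 1 where [f x >= n] and 0 where [f x <= n - 1]; the
   latter holds at each fixed [x] once [n] is large, by pointwise boundedness of [C]. *)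
have hP N : exists h : Cp R X, U h /\ exists n (f : Cp R X), [/\ (N <= n)%N, C f &
    forall x, `|y x - h x| <=
      n.+1%:R^-1 + Num.max 0 (f x - n%:R + 1) * `|g n x - y x|].
  have [n [f [Nn Cf fD]]] := CP N.
  (* [h] equals [g n] on [F n.+1], and [`|h - y| <= n.+1^-1] off [f > n - 1]. *)
  pose d x := g n x - y x.
  pose r x := n.+1%:R^-1 + Num.max 0 (f x - n%:R + 1) * `|d x|.
  have cd : continuous d by move=> x; exact: cvgB (cts_fun x) (cts_fun x).
  have cr : continuous r.
    have cm : continuous (fun x => Num.max 0 (f x - n%:R + 1)).
      apply: continuous_maxr; first exact: cst_continuous.
      move=> x; apply: cvgD; last exact: cvg_cst.
      exact: cvgB (cts_fun x) (cvg_cst _).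
    move=> x; apply: cvgD; first exact: cvg_cst.
    by apply: cvgM; [exact: cm|exact: cvg_norm (cd x)].
  have r0 x : 0 <= r x by rewrite addr_ge0 ?(ltW (eps0 n))// mulr_ge0// le_max lexx.
  have /continuousType_ex[h hE] : continuous (fun x =>
      y x + Num.max (- r x) (- Num.max (- r x) (- d x))).
    have cNr : continuous (fun x => - r x) by move=> x; exact: cvgN (cr x).
    have cNd : continuous (fun x => - d x) by move=> x; exact: cvgN (cd x).
    have cm : continuous (fun x => - Num.max (- r x) (- d x)).
      by move=> x; exact: cvgN (continuous_maxr cNr cNd (x := x)).
    by move=> x; exact: cvgD (cts_fun x) (continuous_maxr cNr cm (x := x)).
  exists h; split; last first.
    exists n, f; split => // x; rewrite hE distrC addrC addKr.
    exact: truncation_le.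
  apply: (gU n) => x xF; rewrite hE.
  suff dr : `|d x| <= r x.
    rewrite -[g n x](subrKC (y x)) -/(d x).
    by rewrite truncation_id.
  have [xFn|xFn] := boolP (x \in F n).
    rewrite /r distrC.
    have /ltW/le_trans := gF n x xFn; apply.
    by rewrite lerDl mulr_ge0// le_max lexx.
  have xD : x \in D n by rewrite mem_filter xFn.
  have fx : 1 <= Num.max 0 (f x - n%:R + 1).
    by rewrite le_max lerDr subr_ge0 (ltW (fD x xD)) orbT.
  rewrite /r -[leLHS]add0r lerD// ?invr_ge0// -[leLHS]mul1r.
  by apply: ler_wpM2r.
have /choice[h hP'] := hP.
exists h; first by move=> N; case: (hP' N).
apply/Cp_cvgP => x; apply/cvgrPdist_lt => e e0.
have : compact ((fun f : Cp R X => f x) @` C).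
  apply: continuous_compact cC; apply: continuous_subspaceT.
  exact: Cp_eval_continuous.
move=> /compact_bounded[M [_ /(_ (M + 1))]].
rewrite ltrDl ltr01 => /(_ isT) MC.
suff : \forall N \near \oo, `|y x - h N x| < e by [].
near=> N.
have [_ [n [f [Nn Cf]]]] := hP' N.
move=> /(_ x) /le_lt_trans; apply.
have /max_idPl -> : f x - n%:R + 1 <= 0.
  suff : `|f x| + 1 <= n%:R by have := ler_norm (f x); lra.
  apply: (@le_trans _ _ N%:R); last by rewrite ler_nat.
  apply: (@le_trans _ _ (M + 1 + 1)).
    by rewrite lerD2r MC//; exists f.
  near: N; exact: nbhs_infty_ger.
rewrite mul0r addr0; apply: (@le_lt_trans _ _ N.+1%:R^-1).
  by rewrite lef_pV2 ?posrE ?ltr0n// ler_nat.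
by near: N; exact: near_infty_natSinv_lt (PosNum e0).
Unshelve. all: by end_near. Qed.

(** * Statement (ii): from first-countable compact sets to Ascoli *)

Lemma first_countable_base (T : topologicalType) (x : T) :
  first_countable T ->
  exists W : nat -> set T, (forall n, nbhs x (W n)) /\
    forall U, nbhs x U -> exists N, forall n, (N <= n)%N -> W n `<=` U.
Proof.
move=> /(_ x)[B [/countable_injP[i iB] Bx Bbase]].
(* [A n] is the basic set with code [n], or the whole space if there is none; intersecting the [A j]
   with [j < n] makes the base decreasing. *)
have /choice[A AP] (n : nat) : exists A : set T,
    nbhs x A /\ forall V, B V -> i V = n -> A = V.
  have [[V [BV iV]]|nV] := pselect (exists V, B V /\ i V = n).
    exists V; split=> [|V' BV' iV']; first exact: Bx.
    by apply: iB; rewrite ?inE// iV iV'.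
  exists setT; split=> [|V BV iV]; first exact: filterT.
  by exfalso; apply: nV; exists V.
exists (fun n => [set t | forall j, (j < n)%N -> A j t]); split.
  elim=> [|n IH]; first by apply: filterS filterT => t _ j.
  apply: filterS2 IH (proj1 (AP n)) => t tn An j.
  by rewrite ltnS leq_eqVlt => /predU1P[->//|]; exact: tn.
move=> U /Bbase[V BV VU]; exists (i V).+1 => n iVn t /(_ _ iVn).
by rewrite (proj2 (AP _) V BV erefl); exact: VU.
Qed.

Lemma first_countable_evenly_continuous (R : realType) (Y : topologicalType)
    (K : set (Ck R Y)) :
  (forall (U : nat -> set Y) (y : Y),
    (forall n, open (U n)) -> (forall n, closure (U n) y) ->
    exists (t : nat -> Y) (m : nat -> nat), [/\ forall j, U (m j) (t j),
      t @ \oo --> y & forall N, \forall j \near \oo, (N <= m j)%N]) ->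
  first_countable (set_type K) -> evenly_continuous K.
Proof.
move=> diag fcK [y k]; apply/cvgrPdist_lt => e e0.
have e20 : 0 < e / 2 by rewrite divr_gt0.
have [W [Wk Wbase]] := first_countable_base k fcK.
pose d (k' : set_type K) z : R := `|(set_val k : Ck R Y) y - (set_val k' : Ck R Y) z|.
have cd k' : continuous (d k').
  move=> z; apply: cvg_norm; apply: cvgB; first exact: cvg_cst.
  exact: (@cts_fun _ _ (set_val k' : Ck R Y)).
pose U n := \bigcup_(k' in W n) (d k' @^-1` [set r | e / 2 < r]).
have oU n : open (U n).
  apply: bigcup_open => k' _; apply: open_comp; last exact: open_gt.
  by move=> z _; exact: cd.
(* If [y] is outside the closure of some [U n], a neighbourhood [V] of [y] misses [U n], so the
   distance is at most [e / 2] on [V] times [W n]. *)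
have [Uy|/existsNP[n]] := pselect (forall n, closure (U n) y); last first.
  move=> /existsNP[V] /not_implyP[Vy UV0].
  exists (V, W n) => //= -[z k'] [/= Vz Wk'].
  apply: (@le_lt_trans _ _ (e / 2)); last by lra.
  rewrite leNgt; apply/negP => lt_d; apply: UV0; exists z; split=> //.
  by exists k'.
have [t [m [tU ty m_oo]]] := diag U y oU Uy; exfalso.
pose O := [set r : R | `|(set_val k : Ck R Y) y - r| < e / 2].
have oO : open O.
  rewrite (_ : O = ball ((set_val k : Ck R Y) y) (e / 2)) ?predeqE//.
  exact: ball_open.
have /cvgrPdist_lt/(_ _ e20)[N _ NP] :
    (set_val k : Ck R Y) (t j) @[j --> \oo] --> (set_val k : Ck R Y) y.
  by apply: cvg_comp ty _; exact: (@cts_fun _ _ (set_val k : Ck R Y)).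
(* Dropping the first [N] terms makes [k] map all of [S] into [O]. Members of [W n] then do so for
   large [n], contradicting the choice of [t j] in [U (m j)]. *)
pose S := range (fun j => t (j + N)%N) `|` [set y].
have cS : compact S by apply: cvg_compact_range; exact: cvg_comp (cvg_addnr N) ty.
have nbO : nbhs (set_val k : Ck R Y)
    [set g : Ck R Y | (g : Y -> R) @` S `<=` O].
  have /Ck_cvgP : nbhs (set_val k : Ck R Y) --> (set_val k : Ck R Y) by [].
  apply=> // _ [z [[j _ <-]|->] <-] /=; last by rewrite /O/= subrr normr0.
  by apply: NP; rewrite /= leq_addl.
have [M MP] := Wbase _ (@initial_continuous _ _ (@set_val _ K) k _ nbO).
near \oo => j.
have [k' Wk' /= d_gt] := tU j.
have Mmj : (M <= m j)%N by near: j; exact: m_oo.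
have Sj : S (t j).
  left; exists (j - N)%N => //; rewrite subnK//.
  by near: j; exact: nbhs_infty_ge.
have : O ((set_val k' : Ck R Y) (t j)) by apply: (MP _ Mmj _ Wk'); exists (t j).
by rewrite /O /= ltNge ltW.
Unshelve. all: by end_near. Qed.

(* Adding the constant 1/(n+1) to the members of U n that are within half of
   that at x0 packs all the U n into one open set, from which any sequence
   tending to y must use U n with n tending to infinity. *)
Lemma Cp_kappa_diagonal (R : realType) (X : topologicalType)
    (U : nat -> set (Cp R X)) (y : Cp R X) :
  kappa_frechet_urysohn (Cp R X) ->
  (forall n, open (U n)) -> (forall n, closure (U n) y) ->
  exists (t : nat -> Cp R X) (m : nat -> nat), [/\ forall j, U (m j) (t j),
    t @ \oo --> y & forall N, \forall j \near \oo, (N <= m j)%N].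
Proof.
move=> kFU oU Uy.
(* Over an empty [X] the function space is a single point, and a constant sequence serves. *)
have [[x0 _]|noX] := pselect (exists x : X, True); last first.
  exists (fun=> y), id; split=> [j||N]; [|exact: cvg_cst|exact: nbhs_infty_ge].
  have [z [Uz _]] := Uy j setT filterT.
  suff -> : y = z by [].
  by apply/continuousEP => x; exfalso; apply: noX; exists x.
have half (a : R) : 0 < a -> 0 < a / 2 by move=> a0; rewrite divr_gt0.
pose c n : R := n.+1%:R^-1.
have c0 n : 0 < c n by rewrite invr_gt0 ltr0n.
have cle m n : (m <= n)%N -> c n <= c m.
  by move=> mn; rewrite lef_pV2 ?posrE ?ltr0n// ler_nat.
have csmall e : 0 < e -> exists n, c n < e.
  move=> e0; have [n _ nP] := near_infty_natSinv_lt (PosNum e0).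
  by exists n; apply: nP => /=.
have shift (a : R) (v : Cp R X) : exists w : Cp R X, forall x, w x = v x - a.
  have /continuousType_ex[w wE] : continuous (fun x => v x - a).
    by move=> x; exact: cvgB (cts_fun x) (cvg_cst _).
  by exists w.
have /choice[sh shE] (p : nat * Cp R X) := shift (c p.1) p.2.
have csh n : continuous (fun v => sh (n, v)).
  move=> v; apply/(Cp_cvgP _ (fmap_filter _ (nbhs_filter v))) => x.
  move=> A; rewrite shE => /(Cp_evalB_continuous (x0 := v)).
  by apply: (@filterS _ _ (nbhs_filter v)) => u /=; rewrite shE.
pose T n := U n `&` [set u : Cp R X | `|y x0 - u x0| < c n / 2].
have oT n : open (T n).
  apply: openI => //.
  apply: (@open_comp _ _ (fun u : Cp R X => u x0)
    [set r : R | `|y x0 - r| < c n / 2]).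
    by move=> u _; exact: Cp_eval_continuous.
  exact: (@ball_open _ _ (y x0) (c n / 2)).
pose G := \bigcup_n ((fun v => sh (n, v)) @^-1` T n).
have oG : open G.
  by apply: bigcup_open => n _; apply: open_comp (oT n) => v _; exact: csh.
have Gy : closure G y.
  move=> V /Cp_nbhs_basis[s [e [e0 sV]]].
  have [n cn] := csmall (e / 2) (half _ e0).
  have [u [Uu [us ux0]]] := Uy n _ (filterI
    (Cp_nbhs_finite y s (half _ e0))
    (Cp_nbhs_finite y [:: x0] (half _ (c0 n)))).
  (* Shifting by [- c n] adds [c n]; both [|y - u|] on [s] and [c n] are below [e / 2]. *)
  have [v vE] := shift (- c n) u.
  exists v; split; last first.
    apply: sV => x xs; rewrite vE opprK opprD addrA.
    have := ler_normB (y x - u x) (c n); have := us x xs.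
    by rewrite (gtr0_norm (c0 n)); lra.
  exists n => //=; suff -> : sh (n, v) = u.
    by split=> //; apply: ux0; rewrite inE.
  by apply/continuousEP => x; rewrite shE vE opprK addrK.
have [v vG vy] := kFU G y oG Gy.
have /choice[m mP] (j : nat) : exists n, T n (sh (n, v j)).
  by have [n _ ?] := vG j; exists n.
have vyx x : v j x @[j --> \oo] --> y x by have /Cp_cvgP/(_ x) := vy.
(* If [m j < N], then [v j x0] exceeds [y x0] by more than [c (m j) / 2 >= c N / 2], which
   convergence at [x0] forbids for large [j]. *)
have m_oo N : \forall j \near \oo, (N <= m j)%N.
  have /cvgrPdist_lt/(_ (c N / 2)) := vyx x0.
  move=> /(_ (half _ (c0 N))); apply: filterS => j vj.
  rewrite leqNgt; apply/negP => /ltnW/cle cmj.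
  have [_ /=] := mP j; rewrite shE /=; move: vj; rewrite !ltr_norml.
  by move=> /andP[? ?] /andP[? ?]; lra.
exists (fun j => sh (m j, v j)), m; split=> //; first by move=> j; case: (mP j).
apply/Cp_cvgP => x; apply/cvgrPdist_lt => e e0.
suff : \forall j \near \oo, `|y x - sh (m j, v j) x| < e by [].
have e20 := half _ e0; have [n cn] := csmall (e / 2) e20.
have /cvgrPdist_lt/(_ _ e20) := vyx x.
have := m_oo n; apply: filterS2 => j /cle cmj vj; rewrite shE/= opprB addrA.
have := ler_normD (y x - v j x) (c (m j)).
by rewrite (gtr0_norm (c0 _)) addrAC; lra.
Unshelve. all: by end_near. Qed.

Theorem theorem1p1 (R : realType) (X : topologicalType)
    (hX : tychonoff_space X) :
  (ascoli_space R (Cp R X) -> kappa_frechet_urysohn (Cp R X)) /\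
  (kappa_frechet_urysohn (Cp R X) ->
   (forall K : set (Ck R (Cp R X)), compact K ->
      first_countable (set_type K)) ->
   ascoli_space R (Cp R X)).
Proof.
split=> [|kFU fcK]; first exact: ascoli_kappa.
split=> [|K cK]; first exact: Cp_tychonoff.
apply: first_countable_evenly_continuous (fcK K cK) => U y oU Uy.
exact: Cp_kappa_diagonal.
Qed.
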